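(* Let $B\in\mathbb{S}_{2n}$ be an involution without fixed points with $n\ge2$ (an arc diagram with more than one arc). Then $\pi(B)=\pi'(B)$ in $\mathcal{A}$; in particular $\pi'(B)$ is a linear combination of classes of fixed-point-free involutions (the coefficients of all products containing classes of permutations with fixed points vanish).
   Context: A permutation $\alpha\in\mathbb{S}_m$ is connected if no proper nonempty subinterval $\{k+1,\dots,n\}\subsetneq[m]$ is invariant under $\alpha$. Two connected $\alpha_1,\alpha_2\in\mathbb{S}_m$ are rotationally equivalent if $\alpha_2=\sigma_m^{-k}\alpha_1\sigma_m^k$ for some $k$, $\sigma_m=(1,\dots,m)$. Every $\alpha\in\mathbb{S}_m$ determines a multiset of connected permutations recursively: $\{\alpha\}$ if $\alpha$ is connected; otherwise, for an invariant proper subinterval $I$, the union of the multisets for $\alpha|_I$ and $\alpha|_{[m]\setminus I}$. $\mathcal{A}$ is the free commutative (polynomial) algebra generated by rotational equivalence classes of connected permutations, and $[\alpha]\in\mathcal{A}$ denotes the product of the classes in the multiset of $\alpha$ ($[\text{empty}]=1$). For $R\subset[m]$, $\alpha|_R$ is the permutation of $R$ sending $r$ to the first element of $\alpha(r),\alpha^2(r),\dots$ lying in $R$, identified with $\mathbb{S}_{|R|}$ by the order-preserving bijection. For $\alpha\in\mathbb{S}_m$ with set of cycles $V(\alpha)$: $\pi(\alpha)=\sum_{k\ge1}(-1)^{k-1}(k-1)!\sum_{\{I_1,\dots,I_k\}}[\alpha|_{I_1}]\cdots[\alpha|_{I_k}]$, over unordered partitions of $V(\alpha)$ into $k$ nonempty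 blocks, $\alpha|_{I}$ meaning restriction to the union of the cycles in $I$; $\pi'(\alpha)=\sum_{k\ge1}(-1)^{k-1}(k-1)!\sum_{\{L_1,\dots,L_k\}}[\alpha|_{L_1}]\cdots[\alpha|_{L_k}]$, over unordered partitions of $[m]$ into $k$ nonempty blocks. *)

(* Defs.v *)
From HB Require Import structures.
From mathcomp Require Import all_boot all_order all_algebra all_fingroup.
From mathcomp Require Import finmap.
From mathcomp Require Import monalg.
Set Implicit Arguments. Unset Strict Implicit. Unset Printing Implicit Defensive.
Import GRing.Theory.
Local Open Scope fset_scope.

Definition apply (s : seq nat) (i : nat) : nat := nth i s i.
Definition isperm (s : seq nat) : bool := perm_eq s (iota 0 (size s)).

Definition inv_interval (s : seq nat) (k n : nat) : bool :=
  perm_eq [seq apply s i | i <- iota k (n - k)] (iota k (n - k)).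

Definition proper_inv_intervals (s : seq nat) : seq (nat * nat) :=
  [seq kn <- [seq (k, n) | k <- iota 0 (size s).+1, n <- iota 0 (size s).+1]
     | [&& kn.1 < kn.2, ~~ ((kn.1 == 0) && (kn.2 == size s)) & inv_interval s kn.1 kn.2]].

Definition connected (s : seq nat) : bool := proper_inv_intervals s == [::].

Definition ret (s : seq nat) (P : pred nat) (r : nat) : nat :=
  let t := [seq iter k.+1 (apply s) r | k <- iota 0 (size s)] in nth r t (find P t).

Definition res (s : seq nat) (P : pred nat) : seq nat :=
  let R := [seq i <- iota 0 (size s) | P i] in [seq index (ret s P r) R | r <- R].

Fixpoint comps (fuel : nat) (s : seq nat) : seq (seq nat) :=
  if s is [::] then [::] else
  match fuel with
  | 0 => [:: s]
  | f.+1 =>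
    match proper_inv_intervals s with
    | [::] => [:: s]
    | kn :: _ =>
      let I := [pred i | kn.1 <= i < kn.2] in
      comps f (res s I) ++ comps f (res s (predC I))
    end
  end.

Definition conjk (s : seq nat) (k : nat) : seq nat :=
  let m := size s in [seq (apply s ((i + k) %% m) + m - k) %% m | i <- iota 0 m].

Definition rotclass (s : seq nat) : {fset (seq nat)} :=
  [fset conjk s k | k in iota 0 (size s)].

Definition is_cclass (c : {fset (seq nat)}) : bool :=
  has (fun s => [&& isperm s, 0 < size s, connected s & rotclass s == c]) c.

Local Open Scope ring_scope.
Definition Gen := {c : {fset (seq nat)} | is_cclass c}.
Definition A := {malg int[cmonom Gen]}.

Definition gen (s : seq nat) : A :=
  if (insub (rotclass s) : option Gen) is Some c then << ucm c >> else 1.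

Definition brk (s : seq nat) : A := \prod_(c <- comps (size s) s) gen c.

Definition oneline m (a : 'S_m) : seq nat := [seq val (a i) | i <- enum 'I_m].

Definition restr m (a : 'S_m) (L : {set 'I_m}) : seq nat :=
  res (oneline a) [pred i : nat | i \in [seq val j | j <- enum L]].

Definition piA m (a : 'S_m) : A :=
  \sum_(P : {set {set {set 'I_m}}} | partition P (porbits a))
     ((-1) ^+ (#|P|.-1) * ((#|P|.-1)`!)%:R) * \prod_(I in P) brk (restr a (cover I)).

Definition piA' m (a : 'S_m) : A :=
  \sum_(P : {set {set 'I_m}} | partition P [set: 'I_m])
     ((-1) ^+ (#|P|.-1) * ((#|P|.-1)`!)%:R) * \prod_(L in P) brk (restr a L).

Definition fpf_inv (s : seq nat) : bool :=
  isperm s && all (fun i => (apply s (apply s i) == i) && (apply s i != i)) (iota 0 (size s)).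

Definition fpf_class (c : Gen) : bool := has fpf_inv (val c).

(* Main.v *)
Require Import Defs.
From HB Require Import structures.
From mathcomp Require Import all_boot all_order all_algebra all_fingroup finmap monalg.
Set Implicit Arguments. Unset Strict Implicit. Unset Printing Implicit Defensive.
Import GRing.Theory.

(** The sums [piA] and [piA'] are cumulants of set functions with value 1 on
    the empty set: F(D) is the sum of K(U) F(D \ U) over the subsets U of D
    containing a fixed element i, and this recursion characterises K.

    Splitting along invariant intervals is confluent, because the trace of an
    interval on any subset is an interval for the induced order.  Hence a
    fixed point can be split off first: if the partner of a point i of L is
    not in L, then [B|_L] = x [B|_(L \ i)], with x the class of the one-point
    permutation.  It follows that the function which is x on single points,
    the cumulant over arcs on unions of at least two arcs, that cumulant minus
    x^2 on single arcs, and 0 elsewhere satisfies the recursion for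
    L |-> [B|_L].  It is therefore the cumulant over points, which agrees with
    the cumulant over arcs as soon as there are two arcs. *)

(** * Proper invariant intervals and the recursion for [brk] *)

Lemma allpairs_iotaE m k n :
  ((k, n) \in [seq (k, n) | k <- iota 0 m.+1, n <- iota 0 m.+1]) =
  (k <= m) && (n <= m).
Proof.
apply/allpairsP/andP => [[[i j] [iP jP [-> ->]]]|[km nm]].
  by move: iP jP; rewrite !mem_iota !add0n !ltnS.
by exists (k, n); split; rewrite // mem_iota add0n ltnS.
Qed.

Lemma mem_proper_inv_intervals s k n :
  ((k, n) \in proper_inv_intervals s) =
  [&& k < n, n <= size s, ~~ ((k == 0) && (n == size s)) & inv_interval s k n].
Proof.
rewrite /proper_inv_intervals mem_filter /= allpairs_iotaE.
case: ltnP => //= kn; case: (leqP n (size s)) => [ns|]; last by rewrite !andbF.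
by rewrite (leq_trans (ltnW kn) ns) !andbT.
Qed.

Lemma size_res s P : size (res s P) = count P (iota 0 (size s)).
Proof. by rewrite /res size_map size_filter. Qed.

Lemma size_res_proper s kn (I := [pred i | kn.1 <= i < kn.2]) :
  kn \in proper_inv_intervals s ->
  (size (res s I) < size s) && (size (res s (predC I)) < size s).
Proof.
case: kn @I => k n I; rewrite mem_proper_inv_intervals => /and4P [kn ns nfull _].
have H P : ~~ all P (iota 0 (size s)) -> size (res s P) < size s.
  rewrite all_count size_iota size_res => nP; rewrite ltn_neqAle nP /=.
  by rewrite -[X in _ <= X](size_iota 0) count_size.
apply/andP; split; apply: H; apply/allPn.
  (* A position outside the interval: [n] if the interval starts at 0, as it is then not everything,
     and 0 otherwise. *)
  case: (posnP k) nfull => [k0 /= nfull|k0 _].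
    by exists n; rewrite ?mem_iota //= ?ltnn ?andbF // add0n ltn_neqAle nfull.
  exists 0; last by rewrite negb_and -ltnNge k0.
  by rewrite mem_iota add0n; apply: leq_ltn_trans (leq0n k) (leq_trans kn ns).
exists k; rewrite ?mem_iota /= ?add0n ?(leq_trans kn ns) //.
by rewrite leqnn kn.
Qed.

(** Both recursive calls act on strictly shorter lists, so fuel at least the length never runs
    out. *)
Lemma comps_fuel f g s : size s <= f -> size s <= g -> comps f s = comps g s.
Proof.
elim: f g s => [|f IH] [|g] [|x s] //= sf sg.
have := @size_res_proper (x :: s).
case: (proper_inv_intervals _) => // kn l /(_ kn); rewrite inE eqxx /=.
move=> /(_ isT) /andP [s1 s2].
by congr (_ ++ _); apply: IH; rewrite -ltnS;
   [apply: leq_trans s1 _|apply: leq_trans s1 _|apply: leq_trans s2 _|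
    apply: leq_trans s2 _].
Qed.

Lemma brk_nil : brk [::] = 1%R.
Proof. by rewrite /brk big_nil. Qed.

Lemma brk_rec s kn l (I := [pred i | kn.1 <= i < kn.2]) :
  proper_inv_intervals s = kn :: l ->
  brk s = (brk (res s I) * brk (res s (predC I)))%R.
Proof.
move=> E; have := @size_res_proper s kn; rewrite E inE eqxx => /(_ isT).
move=> /andP [s1 s2]; rewrite /brk -big_cat /=; congr bigop.
case: s E s1 s2 => // x s E s1 s2.
rewrite [LHS]/= E.
by congr (_ ++ _); apply: comps_fuel.
Qed.

(** * Permutations of finite sets of numbers, and splitting along convex subsets *)

(* The permutation [a] of the set of entries of the increasing list [X], in
   one-line notation after order-preserving relabelling. *)
Definition std (a : nat -> nat) (X : seq nat) : seq nat :=
  [seq index (a x) X | x <- X].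

Definition permutes (a : nat -> nat) (X : seq nat) : Prop :=
  [/\ sorted ltn X, {in X, forall x, a x \in X} & {in X &, injective a}].

Definition invariant_in (a : nat -> nat) (X : seq nat) (Q : pred nat) : Prop :=
  {in X, forall x, Q (a x) = Q x}.

Definition convex_in (X : seq nat) (Q : pred nat) : Prop :=
  {in X & &, forall x y z, x <= y -> y <= z -> Q x -> Q z -> Q y}.

Lemma eq_in_std a b X : {in X, a =1 b} -> std a X = std b X.
Proof. by move=> ab; apply/eq_in_map => x /ab ->. Qed.

Lemma brk_std_nil a : brk (std a [::]) = 1%R.
Proof. exact: brk_nil. Qed.

Lemma size_std a X : size (std a X) = size X.
Proof. by rewrite size_map. Qed.

Lemma index_inj_in (X : seq nat) : {in X &, injective (index^~ X)}.
Proof.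
by move=> x y xX yX e; rewrite -(nth_index 0 xX) e nth_index.
Qed.

Lemma permutes_uniq a X : permutes a X -> uniq X.
Proof. by case; rewrite ltn_sorted_uniq_leq => /andP []. Qed.

Lemma permutes_filter a X Q : permutes a X -> invariant_in a X Q ->
  permutes a (filter Q X).
Proof.
move=> [sX aX ainj] iQ; split.
- exact: sorted_filter ltn_trans _ _ sX.
- by move=> x; rewrite !mem_filter => /andP [Qx xX]; rewrite iQ ?Qx ?aX.
by move=> x y; rewrite !mem_filter => /andP [_ xX] /andP [_ yX]; apply: ainj.
Qed.

Lemma apply_std a X x : x \in X -> apply (std a X) (index x X) = index (a x) X.
Proof.
move=> xX; rewrite /apply (nth_map 0) ?index_mem // nth_index //.
Qed.

Lemma iota_index (X : seq nat) : uniq X ->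
  iota 0 (size X) = [seq index x X | x <- X].
Proof.
move=> uX; apply: (@eq_from_nth _ 0) => [|i]; rewrite size_iota ?size_map // => iX.
by rewrite nth_iota // (nth_map 0) // index_uniq.
Qed.

Lemma index_map_in (T1 T2 : eqType) (f : T1 -> T2) (s : seq T1) x :
  {in s &, injective f} -> x \in s -> index (f x) (map f s) = index x s.
Proof.
elim: s => // y s IH finj; rewrite inE /=; case: (eqVneq y x) => [->|yx] /=.
  by rewrite eqxx.
move=> xs; case: eqP => [/finj|_].
  by rewrite !inE eqxx xs orbT => /(_ isT isT) e; rewrite e eqxx in yx.
by rewrite IH // => u v us vs; apply: finj; rewrite inE ?us ?vs orbT.
Qed.

(** On an invariant subset the first return is already the first iterate, so the restriction keeps
    the map [a]. *)
Lemma res_std a X (P : pred nat) : permutes a X ->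
  invariant_in a X (fun x => P (index x X)) ->
  res (std a X) P = std a [seq x <- X | P (index x X)].
Proof.
move=> pX iP; have uX := permutes_uniq pX; case: (pX) => [sX aX ainj].
rewrite /res size_std iota_index // filter_map -map_comp.
apply/eq_in_map => x; rewrite mem_filter => /andP [/= Px xX].
have axX := aX x xX.
have X0 : 0 < size X by case: (X) xX.
have -> : ret (std a X) P (index x X) = index (a x) X.
  rewrite /ret size_std; case: (size X) X0 => // m _ /=.
  by rewrite apply_std // iP // Px.
rewrite (@index_map_in _ _ (index^~ X)) //.
  by move=> u v; rewrite !mem_filter => /andP [_ uX'] /andP [_ vX]; apply: index_inj_in.
by rewrite mem_filter axX andbT /= iP.
Qed.

Lemma mem_interval k n i : k <= n -> (i \in iota k (n - k)) = (k <= i < n).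
Proof. by move=> kn; rewrite mem_iota subnKC. Qed.

Lemma inv_interval_std a X k n : permutes a X -> k <= n -> n <= size X ->
  inv_interval (std a X) k n <->
  invariant_in a X (fun x => k <= index x X < n).
Proof.
move=> pX kn nX; have uX := permutes_uniq pX; case: (pX) => [sX aX ainj].
have nthX i : i \in iota k (n - k) ->
    exists2 x, x \in X & index x X = i.
  rewrite mem_interval // => /andP [_ /leq_trans/(_ nX) iX].
  by exists (nth 0 X i); rewrite ?mem_nth ?index_uniq.
split=> [/perm_mem E x xX|iQ].
  rewrite -!mem_interval //; apply/idP/idP => [|xi].
    rewrite -E => /mapP [i ii]; have [y yX ey] := nthX _ ii.
    move: ii; rewrite -ey apply_std // => ii e; rewrite (ainj x y) //.
    by apply: index_inj_in e; apply: aX.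
  by rewrite -E -apply_std //; apply: map_f.
(* Mapping the interval into itself is enough: by injectivity and equal lengths the image exhausts
   it. *)
have sub : {subset [seq apply (std a X) i | i <- iota k (n - k)] <= iota k (n - k)}.
  move=> _ /mapP [i /[dup] ii /nthX [x xX e] ->]; move: ii; rewrite -e.
  by rewrite apply_std // !mem_interval // iQ.
have um : uniq [seq apply (std a X) i | i <- iota k (n - k)].
  rewrite map_inj_in_uniq ?iota_uniq // => i j /nthX [x xX <-] /nthX [y yX <-].
  rewrite !apply_std // => e; congr index; apply: ainj => //.
  by apply: index_inj_in e; apply: aX.
apply: uniq_perm => //; first exact: iota_uniq.
by have [] := uniq_min_size um sub; rewrite ?size_map.
Qed.

(** The bounds are the first position satisfying [Q] and one past the last; convexity fills the
    positions between. *)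
Lemma convex_positions X Q : sorted ltn X -> convex_in X Q -> has Q X ->
  exists k n, [/\ k < n, n <= size X &
    {in X, forall x, Q x = (k <= index x X < n)}].
Proof.
move=> sX cQ hQ.
have uX : uniq X by move: sX; rewrite ltn_sorted_uniq_leq => /andP [].
have sleq : sorted leq X by move: sX; rewrite ltn_sorted_uniq_leq => /andP [].
pose p i := (i < size X) && Q (nth 0 X i).
have exp : exists i, p i by case/(has_nthP 0): hQ => i iX Qi; exists i; rewrite /p iX.
have pm i : p i -> i <= size X by case/andP => /ltnW.
case: (ex_minnP exp) => k /andP [kX Qk] kmin.
case: (ex_maxnP exp pm) => n /andP [nX Qn] nmax.
exists k, n.+1; split=> //; first by rewrite ltnS; apply: kmin; rewrite /p nX.
move=> x xX; have ix : index x X < size X by rewrite index_mem.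
apply/idP/idP => [Qx|/andP [kx xn]].
  have px : p (index x X) by rewrite /p ix nth_index.
  by rewrite kmin //= ltnS nmax.
have le u v : u \in X -> v \in X -> index u X <= index v X -> u <= v.
  by move=> uX' vX; apply: (sorted_leq_index leq_trans leqnn sleq).
apply: (cQ (nth 0 X k) x (nth 0 X n)) => //; rewrite ?mem_nth //.
  by apply: le; rewrite ?mem_nth // index_uniq.
by apply: le; rewrite ?mem_nth // index_uniq.
Qed.

Lemma convex_index X k n : sorted ltn X ->
  convex_in X (fun x => k <= index x X < n).
Proof.
move=> sX x y z xX yX zX xy yz /andP [kx _] /andP [_ zn].
have le u v : u \in X -> v \in X -> u <= v -> index u X <= index v X.
  move=> uX vX; apply: contraTT; rewrite -!ltnNge.
  exact: (sorted_ltn_index ltn_trans sX).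
by rewrite (leq_trans kx (le _ _ _ _ xy)) // (leq_ltn_trans (le _ _ _ _ yz) zn).
Qed.

(* The trace of a convex set on any subset is again convex, so two
   decompositions along invariant convex sets have a common refinement. *)
Lemma brk_std_split a X Q : permutes a X -> invariant_in a X Q -> convex_in X Q ->
  brk (std a X) =
  (brk (std a (filter Q X)) * brk (std a (filter (predC Q) X)))%R.
Proof.
have [m] := ubnP (size X); elim: m X Q => // m IH X Q Xm pX iQ cQ.
have [sX _ _] := pX.
have [hQ|nQ] := boolP (has Q X); last first.
  have -> : filter Q X = [::] by apply/eqP; rewrite -(negbK (_ == _)) -has_filter.
  have -> : filter (predC Q) X = X by apply/all_filterP; rewrite all_predC.
  by rewrite brk_std_nil mul1r.
have [aQ|naQ] := boolP (all Q X).
  have -> : filter (predC Q) X = [::].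
    by apply/eqP; rewrite -(negbK (_ == _)) -has_filter has_predC negbK.
  by rewrite (all_filterP aQ) brk_std_nil mulr1.
have [k [n [kn nX Qkn]]] := convex_positions sX cQ hQ.
(* This only shows that the list of intervals is nonempty; the cut made by [comps] uses its first
   entry, the interval [J] below, which may differ from [Q]. *)
have : (k, n) \in proper_inv_intervals (std a X).
  rewrite mem_proper_inv_intervals size_std kn nX /=; apply/andP; split.
    apply: contraNN naQ => /andP [/eqP k0 /eqP nE]; apply/allP => x xX.
    by rewrite Qkn // k0 nE index_mem xX.
  apply/inv_interval_std => //; first exact: ltnW.
  by move=> x xX; have [_ aX _] := pX; rewrite -!Qkn ?aX // iQ.
case E : (proper_inv_intervals (std a X)) => [|[k' n'] l] // _.
have := mem_proper_inv_intervals (std a X) k' n'; rewrite E mem_head size_std.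
move=> /esym /and4P [kn' nX' nfull /inv_interval_std]; move=> /(_ pX (ltnW kn') nX').
pose J x := k' <= index x X < n'; rewrite -/J => iJ.
have cJ : convex_in X J by apply: convex_index.
have iJc : invariant_in a X (predC J) by move=> x xX; rewrite /= iJ.
have iQc : invariant_in a X (predC Q) by move=> x xX; rewrite /= iQ.
have kin : (k', n') \in proper_inv_intervals (std a X) by rewrite E mem_head.
have /andP [] := size_res_proper kin; rewrite (brk_rec E) size_std /=.
have -> : res (std a X) [pred i | k' <= i < n'] = std a (filter J X).
  by rewrite res_std.
have -> : res (std a X) (predC [pred i | k' <= i < n']) = std a (filter (predC J) X).
  by rewrite res_std.
rewrite !size_std => sJ sJc.
have sub R S : invariant_in a X S -> invariant_in a (filter R X) S.
  by move=> iS x; rewrite mem_filter => /andP [_]; apply: iS.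
have csub R S : convex_in X S -> convex_in (filter R X) S.
  move=> cS x y z; rewrite !mem_filter => /andP [_ xX] /andP [_ yX] /andP [_ zX].
  exact: cS.
have sQ : size (filter Q X) < size X.
  by rewrite size_filter ltn_neqAle count_size -all_count naQ.
have sQc : size (filter (predC Q) X) < size X.
  rewrite size_filter ltn_neqAle count_size -all_count andbT.
  by rewrite -has_predC; apply: sub_has hQ => x /=; rewrite negbK.
have refine R S : size (filter R X) < size X -> invariant_in a X R ->
    invariant_in a X S -> convex_in X S ->
    brk (std a (filter R X)) = (brk (std a (filter (predI S R) X)) *
                                brk (std a (filter (predI (predC S) R) X)))%R.
  move=> sR iR iS cS; rewrite !filter_predI; apply: IH.
  - exact: leq_trans sR _.
  - exact: permutes_filter.
  - exact: sub.
  - exact: csub.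
have swap R S : filter (predI R S) X = filter (predI S R) X.
  by apply: eq_filter => x /=; rewrite andbC.
(* Cutting by [J] and then [Q] gives the same four factors as cutting by [Q] and then [J]. *)
rewrite (refine _ _ sJ iJ iQ cQ) (refine _ _ sJc iJc iQ cQ).
rewrite (refine _ _ sQ iQ iJ cJ) (refine _ _ sQc iQc iJ cJ).
rewrite (swap J Q) (swap (predC J) Q) (swap J (predC Q)).
rewrite (swap (predC J) (predC Q)).
exact: mulrACA.
Qed.

(** A single point is always convex, so a fixed point splits off wherever it lies. *)
Lemma brk_std_fixpoint a X x : permutes a X -> x \in X -> a x = x ->
  brk (std a X) = (brk [:: 0] * brk (std a [seq y <- X | y != x]))%R.
Proof.
move=> pX xX ax; have uX := permutes_uniq pX; have [_ aX ainj] := pX.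
have iQ : invariant_in a X (pred1 x).
  by move=> y yX /=; apply/eqP/eqP => [e|->] //; apply: ainj; rewrite ?ax.
have cQ : convex_in X (pred1 x).
  move=> u v w _ _ _ uv vw /eqP eu /eqP ew; apply/eqP/eqP.
  by rewrite eqn_leq -{1}ew vw -eu uv.
have eX : filter (pred1 x) X = [:: x] by rewrite filter_pred1_uniq.
have ex : std a [:: x] = [:: 0] by rewrite /std /= ax eqxx.
by have := brk_std_split pX iQ cQ; rewrite eX ex => E; exact: E.
Qed.

Local Open Scope ring_scope.

(** * Cumulants of set functions and their recursion *)

Section Cumulant.
Variables (T : finType) (R : comNzRingType).
Implicit Types (F K : {set T} -> R) (D U : {set T}) (P Q : {set {set T}}).

(** For [k > 0], the Möbius number of the lattice of partitions of a [k]-element set. The value at 0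
    is 1, so [cumulant F set0] is 1. *)
Definition mobius (k : nat) : R := (-1) ^+ k.-1 * (k.-1)`!%:R.

(** The ground type is arbitrary so that its elements may be points or arcs, the latter being sets
    of points. *)
Definition cumulant F D : R :=
  \sum_(P : {set {set T}} | partition P D) mobius #|P| * \prod_(C in P) F C.

Lemma mobius_rec k : mobius k.+2 + mobius k.+1 *+ k.+1 = 0.
Proof.
rewrite /mobius /= exprS factS natrM mulN1r mulNr mulrCA.
by rewrite [_%:R * _]mulr_natl addNr.
Qed.

Lemma card_blocks_avoiding Q D i : partition Q D -> i \in D ->
  #|[set C in Q | i \notin C]| = #|Q|.-1.
Proof.
move=> QD iD; have tQ := partition_trivIset QD.
have iQ : i \in cover Q by rewrite (cover_partition QD).
rewrite (cardsD1 (pblock Q i) Q) pblock_mem //=.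
apply: eq_card => C; rewrite !inE; case: (boolP (C \in Q)) => [CQ|]; last first.
  by rewrite andbF.
rewrite andbT /=; congr (~~ _); apply/idP/eqP => [iC|->].
  by rewrite (def_pblock tQ CQ iC).
by rewrite mem_pblock.
Qed.

Lemma partition_card1 Q D : partition Q D -> #|Q| = 1%N -> Q = [set D].
Proof.
by move=> QD /eqP/cards1P [C QC]; rewrite -(cover_partition QD) QC cover1.
Qed.

(* Adding the block [D :\: U] to a partition of [U] makes every partition of
   [D] with k + 1 blocks appear k times (once for each block avoiding [i]),
   and these contributions cancel by [mobius_rec]. *)
Lemma cumulant_rec F D i : F set0 = 1 -> i \in D ->
  F D = \sum_(U : {set T} | (i \in U) && (U \subset D))
          cumulant F U * F (D :\: U).
Proof.
move=> F0 iD; rewrite (bigD1 D) ?iD ?subxx //= setDv F0 mulr1.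
rewrite (_ : \sum_(U | _) _ =
  \sum_(Q | partition Q D) (mobius #|Q|.-1 *+ #|Q|.-1) * \prod_(C in Q) F C).
  rewrite -big_split /= (bigD1 [set D]) /=; last first.
    rewrite /partition cover1 eqxx trivIset1 /= inE eq_sym.
    by apply/set0Pn; exists i.
  rewrite cards1 mulr0n mul0r addr0 big_set1 /mobius /= expr0 fact0 !mul1r.
  rewrite big1 ?addr0 // => Q /andP [QD nQ]; rewrite -mulrDl.
  have : #|Q| != 0%N.
    apply/eqP => /cards0_eq Q0; move: iD; rewrite -(cover_partition QD) Q0.
    by rewrite /cover big_set0 inE.
  have : #|Q| != 1%N.
    by apply: contraNneq nQ => Q1; rewrite (partition_card1 QD Q1).
  by case: #|Q| => [|[|k]] // _ _; rewrite mobius_rec mul0r.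
transitivity (\sum_(Q | partition Q D) \sum_(C in Q | i \notin C)
    mobius #|Q|.-1 * \prod_(C in Q) F C); last first.
  apply: eq_bigr => Q QD; rewrite sumr_const mulrnAl; congr (_ *+ _).
  by rewrite -(card_blocks_avoiding QD iD); apply: eq_card => C; rewrite !inE.
under eq_bigr do rewrite /cumulant mulr_suml.
rewrite !pair_big_dep /=.
(* Pairs [(U, P)] correspond to partitions [Q] of [D] with a chosen block [C] avoiding [i], where
   [C] is [D :\: U]. *)
rewrite (reindex_onto (fun q : {set {set T}} * {set T} => (D :\: q.2, q.1 :\ q.2))
   (fun p : {set T} * {set {set T}} => ((D :\: p.1) |: p.2, D :\: p.1))) /=;
   last first.
  move=> [U P] /= /andP [/andP [/andP [iU UD] UnD] PU].
  rewrite setDDr setDv set0U (setIidPr UD); congr pair.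
  (* If [D :\: U] were already a block of [P] it would lie in [U], forcing [U = D]. *)
  rewrite setU1K //; apply: contraNN UnD => /(partitionS PU) sDU.
  rewrite eqEsubset UD; apply/subsetP => x xD.
  by apply: contraT => xU; have := subsetP sDU x; rewrite inE xU xD => /(_ isT);
    rewrite (negbTE xU).
apply: eq_big => [[Q C]|[Q C]] /=; last first.
  move=> /andP [/andP [/andP [/andP [iDC _] DCnD] PQC] /eqP [eQ eC]].
  rewrite eC in eQ.
  have CQ : C \in Q by rewrite -eQ setU11.
  rewrite eC [X in _ = _ * X](big_setD1 C) //= (cardsD1 C Q) CQ /=.
  by rewrite -mulrA [F C * _]mulrC.
rewrite inE iD andbT subsetDl andbT; apply/idP/idP.
  move=> /andP [/andP [/andP [iC DCnD] PQC] /eqP [eQ eC]].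
  rewrite eC in eQ; have CQ : C \in Q by rewrite -eQ setU11.
  rewrite CQ iC !andbT -eQ; have CD : C \subset D by rewrite -eC subsetDl.
  have -> : D = C :|: (D :\: C) by rewrite setDE setUIr setUCr setIT (setUidPr CD).
  apply: partitionU1 => //; first by apply: contraNneq DCnD => ->; rewrite setD0.
  by rewrite -setI_eq0 setDE setICA setICr setI0.
move=> /and3P [QD CQ iC]; rewrite iC (partitionD1 QD CQ).
have CD := partitionS QD CQ.
rewrite setDDr setDv set0U (setIidPr CD) setD1K // eqxx !andbT /=.
apply: contraNneq (partition_neq0 QD CQ) => /setDidPl DC.
by rewrite -(setIidPr CD) setI_eq0.
Qed.

(** The term [U = D] has coefficient [F set0 = 1]; every other term involves a smaller nonempty set,
    so the recursion determines [K] by induction on the size. *)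
Lemma cumulant_unique F K D : F set0 = 1 ->
  (forall (L : {set T}) i, i \in L ->
     F L = \sum_(U : {set T} | (i \in U) && (U \subset L)) K U * F (L :\: U)) ->
  D != set0 -> cumulant F D = K D.
Proof.
move=> F0 HK; have [m] := ubnP #|D|; elim: m D => // m IH D Dm D0.
have [i iD] := set0Pn _ D0.
have := HK D i iD; rewrite {1}(cumulant_rec F0 iD).
rewrite (bigD1 D) ?iD ?subxx //= [in RHS](bigD1 D) ?iD ?subxx //=.
rewrite setDv F0 !mulr1 => E; apply: (addIr _ (etrans E _)); congr (_ + _).
apply: eq_bigr => U /andP [/andP [iU UD] UnD]; rewrite IH //.
  by apply: leq_trans (proper_card _) Dm; rewrite properEneq UnD.
by apply/set0Pn; exists i.
Qed.
End Cumulant.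

(** * Cumulants over points and over the arcs of an involution *)

Section InvolutionCumulant.
Variables (T : finType) (R : comNzRingType) (B : {perm T}).
Variables (F : {set T} -> R) (x : R).
Hypothesis BK : involutive B.
Hypothesis Bfree : forall i, B i != i.
Hypothesis F0 : F set0 = 1.
Hypothesis Fhalf : forall (L : {set T}) i, i \in L -> B i \notin L ->
  F L = x * F (L :\ i).
Implicit Types (L U : {set T}) (V : {set {set T}}).

Let stable U : bool := [forall i in U, B i \in U].
Let arcs U : {set {set T}} := [set porbit B i | i in U].
Let Farcs V : R := F (cover V).

Lemma stableP U : reflect (forall i, i \in U -> B i \in U) (stable U).
Proof. exact: forall_inP. Qed.

Lemma porbit_involution i : porbit B i = [set i; B i].
Proof.
apply/setP => j; rewrite !inE; apply/porbitP/orP => [[k ->]|].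
  elim: k => [|k IH]; first by rewrite expg0 perm1 eqxx; left.
  rewrite expgSr permM; case: IH => /eqP ->; first by right.
  by rewrite BK eqxx; left.
case=> /eqP ->; first by exists 0%N; rewrite expg0 perm1.
by exists 1%N; rewrite expg1.
Qed.

Lemma card_porbits_gt1 : (2 < #|T|)%N -> (1 < #|porbits B|)%N.
Proof.
move=> T2; have /card_gt0P [i _] : (0 < #|T|)%N by apply: leq_trans T2.
have [j jT ij] : exists2 j, j \in [set: T] & j \notin porbit B i.
  apply/subsetPn; apply: contraL T2 => /subset_leq_card; rewrite cardsT -leqNgt.
  by move/leq_trans; apply; rewrite porbit_involution cards2; case: eqP.
have sub : [set porbit B j; porbit B i] \subset porbits B.
  by rewrite subUset !sub1set !imset_f.
apply: leq_trans (subset_leq_card sub).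
by rewrite cards2 eq_porbit_mem ij.
Qed.

Lemma mem_cover_porbits V i : V \subset porbits B ->
  (i \in cover V) = (porbit B i \in V).
Proof.
move=> sV; apply/bigcupP/idP => [[C CV iC]|iV]; last first.
  by exists (porbit B i) => //; apply: porbit_id.
have /imsetP [j _ eC] := subsetP sV _ CV.
by move: CV iC; rewrite eC -eq_porbit_mem => CV /eqP ->.
Qed.

Lemma arcs_sub U : arcs U \subset porbits B.
Proof. by apply/subsetP => _ /imsetP [i _ ->]; apply: imset_f. Qed.

Lemma mem_arcs U i : stable U -> (porbit B i \in arcs U) = (i \in U).
Proof.
move=> /stableP sU; apply/imsetP/idP => [[j jU e]|iU]; last by exists i.
have : i \in porbit B j by rewrite -e porbit_id.
by rewrite porbit_involution !inE => /orP [] /eqP -> //; apply: sU.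
Qed.

Lemma cover_arcs U : stable U -> cover (arcs U) = U.
Proof.
by move=> sU; apply/setP => i; rewrite mem_cover_porbits ?arcs_sub // mem_arcs.
Qed.

Lemma stable_cover V : V \subset porbits B -> stable (cover V).
Proof.
move=> sV; apply/stableP => i; rewrite !mem_cover_porbits //.
suff -> : porbit B (B i) = porbit B i by [].
by rewrite !porbit_involution BK setUC.
Qed.

Lemma arcs_cover V : V \subset porbits B -> arcs (cover V) = V.
Proof.
move=> sV; apply/setP => C; apply/imsetP/idP => [[i]|CV].
  by rewrite mem_cover_porbits // => iV ->.
have /imsetP [j _ eC] := subsetP sV _ CV.
by exists j; rewrite // mem_cover_porbits // -eC.
Qed.

(** For stable [L], [cover] and [arcs] are inverse bijections between the sets of arcs in [L] and
    the stable subsets of [L], and they carry the cumulant recursion over arcs to this one. *)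
Lemma arcs_rec_stable L i : i \in L -> stable L ->
  F L = \sum_(U : {set T} | (i \in U) && (U \subset L))
          (cumulant Farcs (arcs U) *+ stable U) * F (L :\: U).
Proof.
move=> iL sL.
have Fa0 : Farcs set0 = 1 by rewrite /Farcs /cover big_set0.
have iaL : porbit B i \in arcs L by rewrite mem_arcs.
have := cumulant_rec Fa0 iaL; rewrite {1}/Farcs cover_arcs // => ->.
rewrite [RHS](bigID stable) /= [X in _ + X]big1 ?addr0; last first.
  by move=> U /andP [_ /negbTE ->]; rewrite mulr0n mul0r.
rewrite [RHS](reindex_onto cover arcs) /=; last first.
  by move=> U /andP [_ sU]; apply: cover_arcs.
apply: eq_big => [V|V /andP [_ VL]]; last first.
  have sV := subset_trans VL (arcs_sub L).
  rewrite arcs_cover // stable_cover // mulr1n /Farcs; congr (_ * F _).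
  apply/setP => j; rewrite inE !mem_cover_porbits ?inE ?mem_arcs //.
  exact: subset_trans (subsetDl _ _) (arcs_sub L).
apply/andP/idP => [[iV VL]|].
  have sV := subset_trans VL (arcs_sub L).
  rewrite mem_cover_porbits // iV stable_cover // arcs_cover // eqxx !andbT /=.
  apply/subsetP => j; rewrite mem_cover_porbits // => /(subsetP VL).
  by rewrite mem_arcs.
move=> /andP [/andP [/andP [iV VL] _] /eqP eV].
have sV : V \subset porbits B by rewrite -eV arcs_sub.
rewrite -mem_cover_porbits //; split=> //.
by rewrite -eV; apply: imsetS.
Qed.

(** If [L] is not stable, some [p] in [L] lacks its partner. No stable [U] inside [L] contains [p],
    so removing [p] extracts the same factor [x] from both sides. *)
Lemma arcs_rec L i : i \in L -> B i \in L ->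
  F L = \sum_(U : {set T} | (i \in U) && (U \subset L))
          (cumulant Farcs (arcs U) *+ stable U) * F (L :\: U).
Proof.
have [m] := ubnP #|L|; elim: m L => // m IH L Lm iL BiL.
have [sL|] := boolP (stable L); first exact: arcs_rec_stable.
rewrite negb_forall => /existsP [p]; rewrite negb_imply => /andP [pL BpL].
have pi : p != i by apply: contraNneq BpL => ->.
have pBi : p != B i by apply: contraNneq BpL => ->; rewrite BK.
rewrite (Fhalf pL BpL) (IH (L :\ p)); first last.
- by rewrite !inE eq_sym pBi.
- by rewrite !inE eq_sym pi.
- by move: Lm; rewrite (cardsD1 p) pL.
rewrite mulr_sumr; rewrite [LHS]big_mkcond [RHS]big_mkcond /=.
apply: eq_bigr => U _.
have [iU|] /= := boolP (i \in U); last by [].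
have [sU|_] := boolP (stable U); last by rewrite mulr0n !mul0r mulr0 !if_same.
rewrite mulr1n; have pU : U \subset L -> p \notin U.
  move=> UL; apply: contraNN BpL => pU; apply: (subsetP UL).
  exact: (stableP _ sU).
rewrite subsetD1; case: (boolP (U \subset L)) => //= UL; rewrite pU //.
rewrite [F (L :\: U)](Fhalf (i := p)); last 2 first.
- by rewrite inE pU.
- by rewrite inE negb_and BpL orbT.
by rewrite mulrCA !setDDl setUC.
Qed.

Let candidate U : R :=
  x *+ (#|U| == 1%N) + cumulant Farcs (arcs U) *+ stable U
  - x ^+ 2 *+ (U \in porbits B).

(* With u_a the product of the two variables of the arc a, the generating
   function factors as exp(x sum t_i) exp(- x^2 sum u_a) sum_S F(S) u^S; the
   first two factors only change cumulants of single points and single arcs. *)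
Lemma candidate_rec L i : i \in L ->
  F L = \sum_(U : {set T} | (i \in U) && (U \subset L)) candidate U * F (L :\: U).
Proof.
move=> iL; rewrite /candidate.
under eq_bigr do rewrite mulrBl mulrDl.
rewrite sumrB big_split /=.
rewrite [X in X + _ - _](bigD1 [set i]) /=; last by rewrite set11 sub1set.
rewrite cards1 mulr1n [X in _ + X + _ - _]big1 ?addr0; last first.
  move=> U /andP [/andP [iU _] nU]; case: eqP; last by rewrite mulr0n mul0r.
  move=> /eqP /cards1P [j eU]; move: iU nU; rewrite eU inE => /eqP ->.
  by rewrite eqxx.
(* The single-point sum is now [x * F (L :\ i)]. If the partner is in [L], removing it too gives
   [x ^+ 2] times the value off the arc, which the correction cancels. *)
have [BiL|BiL] := boolP (B i \in L).
  rewrite -arcs_rec // (bigD1 (porbit B i)) /=; last first.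
    by rewrite porbit_id porbit_involution subUset !sub1set iL.
  rewrite imset_f // mulr1n big1 ?addr0; last first.
    move=> U /andP [/andP [iU _] nU]; case: imsetP; last by rewrite mulr0n mul0r.
    case=> j _ eU; move: iU nU; rewrite eU -eq_porbit_mem => /eqP ->.
    by rewrite eqxx.
  rewrite (Fhalf (L := L :\ i) (i := B i)); last 2 first.
  - by rewrite !inE Bfree.
  - by rewrite BK !inE eqxx.
  by rewrite porbit_involution setDDl mulrA -expr2 [_ + F L]addrC addrK.
(* If the partner is missing, no stable set or orbit containing [i] fits inside [L]; only the
   single-point term survives. *)
rewrite [X in _ + X - _]big1; last first.
  move=> U /andP [iU UL]; case: (stableP U); last by rewrite mulr0n mul0r.
  by move=> /(_ i iU) /(subsetP UL); rewrite (negbTE BiL).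
rewrite [X in _ - X]big1; last first.
  move=> U /andP [iU UL]; case: imsetP; last by rewrite mulr0n mul0r.
  case=> j _ eU; case/negP: BiL; apply: (subsetP UL); rewrite eU.
  move: iU; rewrite eU -eq_porbit_mem => /eqP <-.
  by rewrite porbit_involution !inE eqxx orbT.
by rewrite subr0 addr0 (Fhalf iL BiL).
Qed.

Lemma cumulant_involution : (1 < #|porbits B|)%N ->
  cumulant F setT = cumulant Farcs (porbits B).
Proof.
move=> nB.
have T2 : (1 < #|[set: T]|)%N.
  apply: leq_trans nB _; rewrite cardsT; exact: leq_imset_card.
rewrite (cumulant_unique F0 candidate_rec); last first.
  by rewrite -card_gt0 ltnW.
(* With two arcs or more, the whole set is neither a point nor an arc, so both corrections
   vanish. *)
have -> : candidate setT = cumulant Farcs (arcs setT).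
  rewrite /candidate gtn_eqF //.
  have -> : stable setT by apply/stableP => i; rewrite !inE.
  case: imsetP => [[i _ eT]|_]; last by rewrite subr0 add0r.
  have sB : porbits B \subset [set setT].
    apply/subsetP => _ /imsetP [j _ ->]; rewrite inE eT eq_porbit_mem.
    by rewrite -eT inE.
  by have := subset_leq_card sB; rewrite cards1 leqNgt nB.
by congr cumulant; apply/setP => C; apply/imsetP/imsetP => [] [i _ ->]; exists i.
Qed.
End InvolutionCumulant.

(** * Restrictions of an involution in one-line notation *)

Lemma size_oneline m (a : 'S_m) : size (oneline a) = m.
Proof. by rewrite size_map size_enum_ord. Qed.

Lemma apply_oneline m (a : 'S_m) (i : 'I_m) : apply (oneline a) i = a i.
Proof.
by rewrite /apply (nth_map i) ?size_enum_ord // nth_ord_enum.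
Qed.

Definition natset m (L : {set 'I_m}) : seq nat :=
  [seq i <- iota 0 m | i \in [seq val j | j <- enum L]].

Lemma mem_natset m (L : {set 'I_m}) (i : 'I_m) : (val i \in natset L) = (i \in L).
Proof.
rewrite mem_filter mem_iota /= add0n ltn_ord andbT mem_map ?mem_enum //.
exact: val_inj.
Qed.

Lemma natsetP m (L : {set 'I_m}) k : k \in natset L -> exists2 i, i \in L & k = val i.
Proof.
rewrite mem_filter => /andP [/mapP [i iL ->] _].
by exists i; rewrite // mem_enum in iL *.
Qed.

Lemma sorted_natset m (L : {set 'I_m}) : sorted ltn (natset L).
Proof. exact: sorted_filter ltn_trans _ _ (iota_ltn_sorted 0 m). Qed.

Section RestrictedInvolution.
Variables (m : nat) (B : 'S_m).
Hypothesis BK : involutive B.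
Implicit Types (L : {set 'I_m}).

(* First return to [L]: a point whose partner is missing becomes fixed. *)
Let back L (k : nat) : nat :=
  if apply (oneline B) k \in natset L then apply (oneline B) k else k.

Lemma backE L (i : 'I_m) : back L i = if B i \in L then B i else i.
Proof. by rewrite /back apply_oneline mem_natset; case: ifP. Qed.

Lemma restr_std L : restr B L = std (back L) (natset L).
Proof.
rewrite /restr /res size_oneline -/(natset L) /std.
apply/eq_in_map => k /[dup] kL /natsetP [i iL ek]; congr index.
rewrite ek backE /ret size_oneline.
have E : (fun j : nat => j \in [seq val j | j <- enum L]) =1 mem (natset L).
  move=> j /=; rewrite mem_filter mem_iota; case: (boolP (_ \in map _ _)) => //=.
  by case/mapP => u _ ->; rewrite add0n ltn_ord.
rewrite (eq_find E).
(* Two iterates suffice: if the partner is outside [L], the next iterate is the point itself. For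
   [m = 1] only one iterate is listed, and the default value of [nth] supplies the point. *)
case: m B BK L i {kL E k ek} iL => [|[|p]] C CK L i iL; first by case: (i).
  by rewrite /= apply_oneline (mem_natset L (C i)); case: (C i \in L).
by rewrite /= !apply_oneline CK !(mem_natset L) iL; case: (C i \in L).
Qed.

Lemma back_permutes L : permutes (back L) (natset L).
Proof.
split; first exact: sorted_natset.
  move=> k /natsetP [i iL ->]; rewrite backE.
  by case: ifP => [BL|_]; rewrite mem_natset.
move=> k l /natsetP [i iL ->] /natsetP [j jL ->]; rewrite !backE.
case: ifP => Bi; case: ifP => Bj => /val_inj.
- by move/perm_inj ->.
- by move=> e; rewrite -e BK iL in Bj.
- by move=> e; rewrite e BK jL in Bi.
by move=> ->.
Qed.

(** The point [i] is fixed by [back L], and its removal leaves the other values unchanged, since its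
    partner is not in [L]. *)
Lemma brk_restr_half L i : i \in L -> B i \notin L ->
  brk (restr B L) = brk [:: 0%N] * brk (restr B (L :\ i)).
Proof.
move=> iL BiL; rewrite !restr_std.
have iX : val i \in natset L by rewrite mem_natset.
have bi : back L (val i) = val i by rewrite backE (negbTE BiL).
rewrite (brk_std_fixpoint (back_permutes L) iX bi).
have -> : [seq y <- natset L | y != val i] = natset (L :\ i).
  apply: (irr_sorted_eq ltn_trans ltnn); try exact: sorted_natset.
    by apply: sorted_filter ltn_trans _ _ (sorted_natset L).
  move=> k; rewrite mem_filter; apply/andP/idP => [[ki /natsetP [j jL ek]]|].
    by move: ki; rewrite ek mem_natset !inE jL andbT.
  move=> /natsetP [j]; rewrite !inE => /andP [ji jL] ->.
  by rewrite mem_natset.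
suff -> : std (back L) (natset (L :\ i)) = std (back (L :\ i)) (natset (L :\ i)) by [].
apply: eq_in_std => k /natsetP [j]; rewrite !inE => /andP [ji jL] ->.
rewrite !backE !inE; suff -> : B j != i by [].
by apply: contraNneq BiL => <-; rewrite BK.
Qed.

Lemma brk_restr0 : brk (restr B set0) = 1.
Proof.
rewrite restr_std; have -> : natset (set0 : {set 'I_m}) = [::]; last exact: brk_std_nil.
by case E : (natset _) => [|k l] //; have /natsetP [i] : k \in natset (set0 : {set 'I_m});
  rewrite ?E ?mem_head // inE.
Qed.

Lemma back_stable L k : (forall i, i \in L -> B i \in L) ->
  (forall i, B i != i) -> k \in natset L ->
  (back L (back L k) == k) && (back L k != k).
Proof.
move=> sL Bfree /natsetP [i iL ->]; rewrite backE sL // backE BK iL eqxx /=.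
by apply: contraNneq (Bfree i) => e; apply/eqP/val_inj.
Qed.
End RestrictedInvolution.

(** * Supports on classes of fixed-point-free involutions *)

Lemma fpf_inv_std a X : permutes a X ->
  {in X, forall x, (a (a x) == x) && (a x != x)} -> fpf_inv (std a X).
Proof.
move=> pX fX; have uX := permutes_uniq pX; have [_ aX ainj] := pX.
rewrite /fpf_inv /isperm size_std iota_index //; apply/andP; split.
  have us : uniq (std a X).
    rewrite map_inj_in_uniq // => x y xX yX e; apply: ainj => //.
    by apply: index_inj_in e; apply: aX.
  apply: uniq_perm => //; first by rewrite map_inj_in_uniq //; apply: index_inj_in.
  have sub : {subset std a X <= [seq index x X | x <- X]}.
    by move=> _ /mapP [x xX ->]; apply: map_f; apply: aX.
  by have [] := uniq_min_size us sub; rewrite ?size_map.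
rewrite all_map; apply/allP => x xX /=; rewrite !apply_std ?aX //.
have /andP [/eqP -> ne] := fX x xX; rewrite eqxx /=.
by apply: contraNneq ne => e; apply/eqP; apply: index_inj_in e; rewrite ?aX.
Qed.

(** All cuts are along invariant subsets, where [a] is still a fixed-point-free involution. *)
Lemma comps_std_fpf f a X : permutes a X ->
  {in X, forall x, (a (a x) == x) && (a x != x)} ->
  all fpf_inv (comps f (std a X)).
Proof.
elim: f X => [|f IH] X pX fX.
  have := fpf_inv_std pX fX; by case: (std a X) => //= x s ->.
have fs := fpf_inv_std pX fX; rewrite /=.
case Es : (std a X) fs => [|x0 s0] // fs; rewrite -Es.
case E : (proper_inv_intervals (std a X)) => [|[k n] l]; first by rewrite /= Es fs.
have := mem_proper_inv_intervals (std a X) k n; rewrite E mem_head size_std.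
move=> /esym /and4P [kn nX _ /inv_interval_std]; move=> /(_ pX (ltnW kn) nX).
pose J x := (k <= index x X < n)%N; rewrite -/J => iJ.
have iJc : invariant_in a X (predC J) by move=> x xX; rewrite /= iJ.
rewrite all_cat; apply/andP; split; rewrite res_std //; apply: IH.
- exact: (permutes_filter pX iJ).
- by move=> x; rewrite mem_filter => /andP [_]; apply: fX.
- exact: (permutes_filter pX iJc).
by move=> x; rewrite mem_filter => /andP [_]; apply: fX.
Qed.

Lemma conjk0 s : isperm s -> conjk s 0 = s.
Proof.
move=> ps; apply: (@eq_from_nth _ 0%N); first by rewrite size_map size_iota.
move=> i; rewrite size_map size_iota => iS.
rewrite (nth_map 0%N) ?size_iota // nth_iota // add0n addn0 subn0.
rewrite (modn_small iS) modnDr /apply (set_nth_default 0%N) // modn_small //.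
have : nth 0%N s i \in iota 0 (size s) by rewrite -(perm_mem ps) mem_nth.
by rewrite mem_iota.
Qed.

(** The polynomial subring on the generators satisfying [fpf_class]. *)
Definition fpf_supported (g : A) : Prop :=
  forall mo : cmonom Gen, g@_mo != 0 -> forall c, c \in finsupp mo -> fpf_class c.

Lemma fpf_supported0 : fpf_supported 0.
Proof. by move=> mo; rewrite mcoeff0 eqxx. Qed.

Lemma fpf_supported1 : fpf_supported 1.
Proof.
move=> mo; rewrite mcoeff1; case: (eqVneq mo mone) => [->|_]; last by rewrite eqxx.
by move=> _ c; rewrite mdom1 inE.
Qed.

Lemma fpf_supportedN g : fpf_supported g -> fpf_supported (- g).
Proof. by move=> hg mo; rewrite mcoeffN oppr_eq0; apply: hg. Qed.

Lemma fpf_supportedD g h : fpf_supported g -> fpf_supported h -> fpf_supported (g + h).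
Proof.
move=> hg hh mo; rewrite mcoeffD; case: (eqVneq g@_mo 0) => [->|/hg //].
by rewrite add0r; apply: hh.
Qed.

Lemma fpf_supportedM g h : fpf_supported g -> fpf_supported h -> fpf_supported (g * h).
Proof.
move=> hg hh mo; rewrite mcoeff_neq0 => /msuppM_le [k1 [k2 [m1 m2 ->]]] c.
rewrite mdomD inE => /orP [c1|c2].
  by apply: (hg k1) => //; rewrite mcoeff_neq0.
by apply: (hh k2) => //; rewrite mcoeff_neq0.
Qed.

Lemma fpf_supported_nat n : fpf_supported n%:R.
Proof.
elim: n => [|n IH]; first exact: fpf_supported0.
by rewrite -natr1; apply: fpf_supportedD => //; apply: fpf_supported1.
Qed.

Lemma fpf_supported_sign n : fpf_supported ((-1) ^+ n).
Proof.
elim: n => [|n IH]; first exact: fpf_supported1.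
rewrite exprS; apply: fpf_supportedM IH.
by apply: fpf_supportedN; apply: fpf_supported1.
Qed.

(** The class of [s] contains [s] as its rotation by 0, and [fpf_class] asks for one such member. *)
Lemma fpf_supported_gen s : fpf_inv s -> fpf_supported (gen s).
Proof.
move=> fs; rewrite /gen; case: insubP => [c _ ec|_]; last exact: fpf_supported1.
move=> mo; rewrite mcoeffU1; case: (eqVneq (ucm c) mo) => [<- _|_]; last by rewrite eqxx.
move=> c'; rewrite mdomU inE => /eqP ->.
(* The empty list has an empty set of rotations, which is not a generator. *)
have s0 : (0 < size s)%N.
  rewrite lt0n; apply/negP => /nilP s0; have := valP c; rewrite ec s0.
  case/hasP => t; rewrite /rotclass => /imfsetP [k /=].
  by rewrite in_nil.
apply/hasP; exists s => //; rewrite ec; apply/imfsetP; exists 0%N => /=.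
  by rewrite mem_iota.
by rewrite conjk0 //; case/andP: fs.
Qed.

Lemma fpf_supported_brk a X : permutes a X ->
  {in X, forall x, (a (a x) == x) && (a x != x)} -> fpf_supported (brk (std a X)).
Proof.
move=> pX fX; rewrite /brk big_seq.
apply: (big_ind fpf_supported) => [| |s].
- exact: fpf_supported1.
- exact: fpf_supportedM.
by move=> /(allP (comps_std_fpf _ pX fX)); apply: fpf_supported_gen.
Qed.

Theorem theorem18 (n : nat) (B : 'S_(2 * n)) :
  (1 < n)%N -> (B * B = 1)%g -> (forall i, B i != i) ->
  piA B = piA' B /\
  (forall mo : cmonom Gen, (piA' B)@_mo != 0 -> forall c, c \in finsupp mo -> fpf_class c).
Proof.
move=> n1 BB Bfree.
have BK : involutive B by move=> i; rewrite -permM BB perm1.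
have E : piA B = piA' B.
  (* By definition [piA'] is the cumulant over points of this [F], and [piA] the cumulant over arcs
     of [F] on unions of arcs. *)
  symmetry; apply: (cumulant_involution BK Bfree (brk_restr0 BK)
    (x := brk [:: 0%N]) (F := fun L => brk (restr B L))).
    by move=> L i; apply: brk_restr_half.
  apply: card_porbits_gt1 => //; rewrite card_ord.
  by apply: leq_trans (_ : 2 * 2 <= _)%N; rewrite ?leq_mul2l.
(* The support is read off from [piA], whose blocks cover stable sets, so that no restriction has a
   fixed point. *)
split=> //; rewrite -E -/(fpf_supported (piA B)).
apply: (big_ind fpf_supported) => [| |P PB].
- exact: fpf_supported0.
- exact: fpf_supportedD.
apply: fpf_supportedM.
  by apply: fpf_supportedM; [apply: fpf_supported_sign|apply: fpf_supported_nat].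
apply: (big_ind fpf_supported) => [| |V VP].
- exact: fpf_supported1.
- exact: fpf_supportedM.
have sV : forall i, i \in cover V -> B i \in cover V.
  by apply/stableP; apply: stable_cover => //; apply: partitionS PB VP.
rewrite restr_std //; apply: fpf_supported_brk; first exact: back_permutes.
by move=> k kV; apply: back_stable.
Qed.
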